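(* For each $n \geq 2$ let $P_n$ be the path graph on $n$ vertices, and let $v(P_n) \in \mathbb{R}^n_{\geq 0}$, $\|v(P_n)\| = 1$, be the Perron-Frobenius eigenvector of its graph distance matrix. Then $$\lim_{n\rightarrow\infty} \left\langle v(P_n), \frac{\mathbb{1}}{\sqrt{n}} \right\rangle = \frac{\sqrt{2}\,\sinh c}{\sqrt{c}\,\sqrt{c + \cosh c\,\sinh c}} = 0.98261\dots,$$ where $c$ is the positive number satisfying $c \tanh c = 1$.
   Context: The path graph $P_n$ has vertices $u_1,\dots,u_n$ with $u_i$ and $u_{i+1}$ adjacent for $1 \leq i \leq n-1$ and no other edges. The graph distance matrix of a finite connected graph with vertices $u_1,\dots,u_n$ is the matrix $D \in \mathbb{R}^{n\times n}$ with $D_{ij} = d(u_i,u_j)$, where $d$ is the graph (shortest-path) distance; for $P_n$ this is $D_{ij} = |i-j|$. The Perron-Frobenius eigenvector of $D$ is the eigenvector with nonnegative entries associated to the largest eigenvalue of $D$. $\mathbb{1} = (1,\dots,1) \in \mathbb{R}^n$, $\langle\cdot,\cdot\rangle$ is the standard Euclidean inner product, and $\|\cdot\|$ is the Euclidean ($\ell^2$) norm on $\mathbb{R}^n$. *)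

(* Defs.v *)
From HB Require Import structures.
From mathcomp Require Import all_boot all_order all_algebra.
From mathcomp Require Import all_classical all_reals all_analysis.

Set Implicit Arguments.
Unset Strict Implicit.
Unset Printing Implicit Defensive.

Import Order.TTheory GRing.Theory Num.Theory.
Import numFieldNormedType.Exports.

Local Open Scope ring_scope.

(* The vertices u_1, ..., u_n are the ordinals 0, ..., n - 1. *)
Definition path_graph (n : nat) : rel 'I_n :=
  fun i j => (i.+1 == j :> nat) || (j.+1 == i :> nat).

(* Least number of edges of a walk from x to y. A shortest walk has fewer than
   #|T| edges, so the search is bounded; the value is #|T| when y is not
   reachable from x, which does not happen in a connected graph. *)
Definition graph_dist (T : finType) (e : rel T) (x y : T) : nat :=
  find (fun k => [exists p : k.-tuple T, path e x p && (last x p == y)])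
       (iota 0 #|T|).

Definition distance_matrix (R : realType) (n : nat) (e : rel 'I_n) : 'M[R]_n :=
  \matrix_(i, j) (graph_dist e i j)%:R.
Arguments distance_matrix R {n} e.

(* The norm that MathComp-Analysis puts on matrices is the sup norm, hence the
   explicit Euclidean structure. *)
Definition inner (R : realType) (n : nat) (u v : 'rV[R]_n) : R :=
  \sum_i u 0 i * v 0 i.

Definition l2norm (R : realType) (n : nat) (v : 'rV[R]_n) : R :=
  Num.sqrt (inner v v).

(* Eigenvectors are row vectors, as in eigenspace; distance matrices of
   undirected graphs are symmetric, so the side does not matter. The norm is
   left free: a unit normalization is imposed separately. *)
Definition perron_frobenius_vector (R : realType) (n : nat) (D : 'M[R]_n)
    (v : 'rV[R]_n) : Prop :=
  exists a : R,
    [/\ eigenvalue D a,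
        forall b : R, eigenvalue D b -> b <= a,
        (v <= eigenspace D a)%MS,
        v != 0
      & forall i, 0 <= v 0 i].

Definition sinh (R : realType) (x : R) : R := (expR x - expR (- x)) / 2.
Definition cosh (R : realType) (x : R) : R := (expR x + expR (- x)) / 2.
Definition tanh (R : realType) (x : R) : R := sinh x / cosh x.

(* Main.v *)
(* An eigenvector w of the matrix |i - j| satisfies, by second differences,
   a (w_(i+1) - 2 w_i + w_(i-1)) = 2 w_i. For a > 0 this forces
   w_k = A cosh (h (2 k - n + 1)) + B sinh (h (2 k - n + 1)) with
   2 a sinh(h)^2 = 1, and the end rows of the eigenvalue equation give B = 0 and
   n tanh (x / n) tanh x = 1 for x = n h. Hence x >= c and x --> c, where
   c tanh c = 1, while summing cosh over arithmetic progressions expresses the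
   inner product as a continuous function of x and n sinh (x / n). The limit
   simplifies to sqrt 2 / c^2, so the decimals follow from an enclosure of c. *)

Require Import Defs.
From HB Require Import structures.
From mathcomp Require Import all_boot all_order all_algebra.
From mathcomp Require Import all_classical all_reals all_analysis.
From mathcomp Require Import zify ring lra.

Set Implicit Arguments.
Unset Strict Implicit.
Unset Printing Implicit Defensive.

Import Order.TTheory GRing.Theory Num.Theory.
Import numFieldNormedType.Exports.

Local Open Scope classical_set_scope.
Local Open Scope ring_scope.

(** * Hyperbolic functions: addition formulas, monotonicity, derivatives, bounds *)

Section Hyperbolic.
Variable R : realType.
Implicit Types x y : R.

Lemma coshN x : cosh (- x) = cosh x.
Proof. by rewrite /cosh opprK addrC. Qed.

Lemma sinhN x : sinh (- x) = - sinh x.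
Proof. by rewrite /sinh opprK; lra. Qed.

Lemma sinh0 : sinh 0 = 0 :> R.
Proof. by rewrite /sinh oppr0 subrr mul0r. Qed.

Lemma cosh0 : cosh 0 = 1 :> R.
Proof. by rewrite /cosh oppr0 expR0; lra. Qed.

Lemma coshD x y : cosh (x + y) = cosh x * cosh y + sinh x * sinh y.
Proof. by rewrite /cosh /sinh opprD !expRD; lra. Qed.

Lemma sinhD x y : sinh (x + y) = sinh x * cosh y + cosh x * sinh y.
Proof. by rewrite /cosh /sinh opprD !expRD; lra. Qed.

Lemma coshB x y : cosh (x - y) = cosh x * cosh y - sinh x * sinh y.
Proof. by rewrite coshD coshN sinhN mulrN. Qed.

Lemma sinhB x y : sinh (x - y) = sinh x * cosh y - cosh x * sinh y.
Proof. by rewrite sinhD coshN sinhN mulrN. Qed.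

Lemma cosh2Bsinh2 x : cosh x ^+ 2 - sinh x ^+ 2 = 1.
Proof. by rewrite -(expRxMexpNx_1 x) /cosh /sinh; lra. Qed.

Lemma cosh_gt0 x : 0 < cosh x.
Proof. by rewrite /cosh; have := expR_gt0 x; have := expR_gt0 (- x); lra. Qed.

Lemma cosh_ge1 x : 1 <= cosh x.
Proof. by have := cosh2Bsinh2 x; have := cosh_gt0 x; nra. Qed.

Lemma sinh_gt0 x : 0 < x -> 0 < sinh x.
Proof.
by move=> x0; have : expR (- x) < expR x;
  [rewrite ltr_expR | rewrite /sinh]; lra.
Qed.

Lemma sinh_ge0 x : 0 <= x -> 0 <= sinh x.
Proof.
by rewrite le_eqVlt => /predU1P[<-|/sinh_gt0/ltW//]; rewrite sinh0.
Qed.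

Lemma ltr_sinh x y : x < y -> sinh x < sinh y.
Proof.
move=> xy; have : expR x < expR y by rewrite ltr_expR.
have : expR (- y) < expR (- x) by rewrite ltr_expR; lra.
by rewrite /sinh; lra.
Qed.

Lemma ltr_tanh x y : x < y -> tanh x < tanh y.
Proof.
move=> xy; rewrite /tanh ltr_pdivlMr ?cosh_gt0// mulrAC ltr_pdivrMr ?cosh_gt0//.
have : 0 < sinh (y - x) by apply: sinh_gt0; rewrite subr_gt0.
by rewrite sinhB; lra.
Qed.

Lemma tanh0 : tanh 0 = 0 :> R.
Proof. by rewrite /tanh sinh0 mul0r. Qed.

Lemma tanh_gt0 x : 0 < x -> 0 < tanh x.
Proof. by move/ltr_tanh; rewrite tanh0. Qed.

(** This gives uniqueness of [c] and lets a positive number be compared with [c] through its value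
    of [x * tanh x]. *)
Lemma ltr_mul_tanh x y : 0 < x -> x < y -> x * tanh x < y * tanh y.
Proof.
by move=> x0 xy; apply: ltr_pM; rewrite ?ltr_tanh// ltW// tanh_gt0.
Qed.

Global Instance is_derive_sinh x : is_derive x 1 (@sinh R) (cosh x).
Proof.
rewrite /sinh /cosh; apply: is_derive_eq.
by rewrite /GRing.scale/=; lra.
Qed.

Global Instance is_derive_cosh x : is_derive x 1 (@cosh R) (sinh x).
Proof.
rewrite /sinh /cosh; apply: is_derive_eq.
by rewrite /GRing.scale/=; lra.
Qed.

Lemma continuous_sinh : continuous (@sinh R).
Proof.
by move=> x; apply/differentiable_continuous/derivable1_diffP/ex_derive.
Qed.

Lemma continuous_cosh : continuous (@cosh R).
Proof.
by move=> x; apply/differentiable_continuous/derivable1_diffP/ex_derive.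
Qed.

Lemma continuous_tanh : continuous (@tanh R).
Proof.
move=> x; apply: cvgM; first exact: continuous_sinh.
by apply: cvgV; [rewrite gt_eqF ?cosh_gt0|exact: continuous_cosh].
Qed.

Lemma derive_ge0_le (f f' : R -> R) x :
  (forall y, is_derive y 1 f (f' y)) -> (forall y, 0 <= y -> 0 <= f' y) ->
  0 <= x -> f 0 <= f x.
Proof.
move=> df f'0 x0; apply: (@ger0_derive1_ndecry R f 0) => //.
- by move=> y; rewrite in_itv/= andbT => /ltW/f'0; rewrite derive1E derive_val.
- apply: continuous_subspaceT => y.
  by apply/differentiable_continuous/derivable1_diffP/ex_derive.
Qed.

Lemma le_sinh x : 0 <= x -> x <= sinh x.
Proof.
move=> x0; pose f y := sinh y - y.
have := @derive_ge0_le f (fun y => cosh y - 1) x.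
rewrite /f sinh0 subr0 subr_ge0; apply => // y _.
by rewrite subr_ge0 cosh_ge1.
Qed.

Lemma sinh_le x : 0 <= x -> sinh x <= x * cosh x.
Proof.
move=> x0; pose f y := y * cosh y - sinh y.
have := @derive_ge0_le f (fun y => y * sinh y) x.
rewrite /f sinh0 mul0r subr0 subr_ge0; apply => // y.
  by apply: is_derive_eq; rewrite /GRing.scale/=; lra.
by move=> y0; rewrite mulr_ge0// sinh_ge0.
Qed.

End Hyperbolic.

(** * Bounds for the exponential and the enclosure of [c] *)

Section Taylor.
Variable R : realType.
Implicit Types x y : R.

Lemma expR_ge_sum x n : 0 <= x -> \sum_(k < n) x ^+ k / k`!%:R <= expR x.
Proof.
move=> x0; rewrite -(big_mkord xpredT (fun k => x ^+ k / k`!%:R)).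
apply: (@nondecreasing_cvgn_le _ (series (exp_coeff x))).
  by apply: nondecreasing_series => k _ _; exact: exp_coeff_ge0.
exact: is_cvg_series_exp_coeff.
Qed.

(** Since n! k! <= (n + k)!, the tail of the series is termwise at most x^n / n! times the series
    itself. *)
Lemma expR_le_sum x n : 0 <= x ->
  expR x <= \sum_(k < n) x ^+ k / k`!%:R + x ^+ n / n`!%:R * expR x.
Proof.
move=> x0; apply: limr_le; first exact: is_cvg_series_exp_coeff.
near=> m.
have nm : (n <= m)%N by near: m; exact: nbhs_infty_ge.
rewrite /series/= -(subnKC nm) big_mkord big_split_ord/= lerD2l.
apply: (@le_trans _ _ (x ^+ n / n`!%:R * \sum_(k < m - n) x ^+ k / k`!%:R)).
  rewrite mulr_sumr; apply: ler_sum => k _; rewrite /exp_coeff/= exprD mulrACA.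
  rewrite ler_wpM2l ?mulr_ge0 ?exprn_ge0// -invfM lef_pV2 ?posrE ?mulr_gt0 ?ltr0n ?fact_gt0//.
  rewrite -natrM ler_nat -(bin_fact (leq_addr k n)) addKn leq_pmull//.
  by rewrite bin_gt0 leq_addr.
rewrite ler_wpM2l ?mulr_ge0 ?exprn_ge0 ?invr_ge0//.
exact: expR_ge_sum.
Unshelve. all: by end_near. Qed.

(** As tanh x = (e^(2x) - 1) / (e^(2x) + 1), comparing x tanh x with 1 reduces to a numerical bound
    on e^(2x). *)
Lemma mul_tanh_sub1 x :
  x * tanh x - 1 = (expR (2 * x) * (x - 1) - (x + 1)) / (expR (2 * x) + 1).
Proof.
have := expR_gt0 x; rewrite expRM_natl /tanh /sinh /cosh expRN.
by move: (expR x) => e e0; field; rewrite !gt_eqF//; nra.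
Qed.

Lemma mul_tanh_lt1 x : (x * tanh x < 1) = (expR (2 * x) * (x - 1) < x + 1).
Proof.
have w0 : 0 < expR (2 * x) + 1 by rewrite addr_gt0// expR_gt0.
by rewrite -subr_lt0 mul_tanh_sub1 pmulr_llt0 ?invr_gt0// subr_lt0.
Qed.

Lemma mul_tanh_gt1 x : (1 < x * tanh x) = (x + 1 < expR (2 * x) * (x - 1)).
Proof.
have w0 : 0 < expR (2 * x) + 1 by rewrite addr_gt0// expR_gt0.
by rewrite -subr_gt0 mul_tanh_sub1 pmulr_lgt0 ?invr_gt0// subr_gt0.
Qed.

Lemma expR_double_le x a b : expR x <= a -> a ^+ 2 <= b -> expR (2 * x) <= b.
Proof.
move=> xa; apply: le_trans; rewrite expRM_natl ler_pXn2r ?nnegrE ?expR_ge0//.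
exact: le_trans (expR_ge0 x) xa.
Qed.

Lemma expR_double_ge x a b :
  0 <= a -> a <= expR x -> b <= a ^+ 2 -> b <= expR (2 * x).
Proof.
move=> a0 ax ba; apply: le_trans ba _.
by rewrite expRM_natl ler_pXn2r ?nnegrE ?expR_ge0.
Qed.

(* Since the limit is sqrt 2 / c ^+ 2 = 0.982619..., the upper bound 0.98262
   only holds because c > 1.1996781. With lo = 32 z, expR (2 * lo) is obtained
   from a short Taylor sum for expR z by six squarings, rounding each time, so
   that lra never sees large integers. *)
Definition mul_tanh_root_lo : R := 32 * (3748 / 10 ^+ 5 + 9947 / 10 ^+ 9).
Definition mul_tanh_root_hi : R := 32 * (3749 / 10 ^+ 5 + 9 / 10 ^+ 8).
Local Notation lo := mul_tanh_root_lo.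
Local Notation hi := mul_tanh_root_hi.

Lemma mul_tanh_lo : lo * tanh lo < 1.
Proof.
rewrite mul_tanh_lt1.
(* For x > 1 the goal reads e^(2x) < (x + 1) / (x - 1); the constant lies just below that quotient
   at [lo]. *)
suff E6 : expR (2 * lo) <= 11 + 160 / 10 ^+ 4 + 9377 / 10 ^+ 8
  by move: E6; rewrite /mul_tanh_root_lo; lra.
pose z : R := 3748 / 10 ^+ 5 + 9947 / 10 ^+ 9.
have -> : 2 * lo = 2 * (2 * (2 * (2 * (2 * (2 * z))))) by rewrite /mul_tanh_root_lo /z; lra.
have z0 : 0 <= z by rewrite /z; lra.
have E0 : expR z <= 1 + 382 / 10 ^+ 4 + 157 / 10 ^+ 8.
  (* The exponential occurs on both sides; it is treated as an unknown [E], in which the inequality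
     is linear with coefficient z^5 / 5! < 1 on the right. *)
  have := expR_le_sum 5 z0; rewrite !big_ord_recr big_ord0/=.
  rewrite !factS fact0 /z.
  by move: (expR _) => E; lra.
clear z0; clearbody z.
have {E0}E1 : expR (2 * z) <= 1 + 778 / 10 ^+ 4 + 6250 / 10 ^+ 8.
  by apply: expR_double_le E0 _; lra.
have {E1}E2 : expR (2 * (2 * z)) <= 1 + 1617 / 10 ^+ 4 + 8757 / 10 ^+ 8.
  by apply: expR_double_le E1 _; lra.
have {E2}E3 : expR (2 * (2 * (2 * z))) <= 1 + 3497 / 10 ^+ 4 + 5036 / 10 ^+ 8.
  by apply: expR_double_le E2 _; lra.
have {E3}E4 : expR (2 * (2 * (2 * (2 * z)))) <=
    1 + 8218 / 10 ^+ 4 + 2604 / 10 ^+ 8.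
  by apply: expR_double_le E3 _; lra.
have {E4}E5 : expR (2 * (2 * (2 * (2 * (2 * z))))) <=
    3 + 3190 / 10 ^+ 4 + 5013 / 10 ^+ 8.
  by apply: expR_double_le E4 _; lra.
by apply: expR_double_le E5 _; lra.
Qed.

Lemma mul_tanh_hi : 1 < hi * tanh hi.
Proof.
rewrite mul_tanh_gt1.
suff E6 : 11 + 161 / 10 ^+ 4 + 7640 / 10 ^+ 8 <= expR (2 * hi)
  by move: E6; rewrite /mul_tanh_root_hi; lra.
pose z : R := 3749 / 10 ^+ 5 + 9 / 10 ^+ 8.
have -> : 2 * hi = 2 * (2 * (2 * (2 * (2 * (2 * z))))) by rewrite /mul_tanh_root_hi /z; lra.
have z0 : 0 <= z by rewrite /z; lra.
have E0 : 1 + 382 / 10 ^+ 4 + 170 / 10 ^+ 8 <= expR z.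
  have := expR_ge_sum 5 z0; rewrite !big_ord_recr big_ord0/=.
  rewrite !factS fact0 /z.
  by move: (expR _) => E; lra.
clear z0; clearbody z.
have {E0}E1 : 1 + 778 / 10 ^+ 4 + 6276 / 10 ^+ 8 <= expR (2 * z).
  by apply: expR_double_ge E0 _; lra.
have {E1}E2 : 1 + 1617 / 10 ^+ 4 + 8812 / 10 ^+ 8 <= expR (2 * (2 * z)).
  by apply: expR_double_ge E1 _; lra.
have {E2}E3 : 1 + 3497 / 10 ^+ 4 + 5163 / 10 ^+ 8 <= expR (2 * (2 * (2 * z))).
  by apply: expR_double_ge E2 _; lra.
have {E3}E4 : 1 + 8218 / 10 ^+ 4 + 2946 / 10 ^+ 8 <=
    expR (2 * (2 * (2 * (2 * z)))).
  by apply: expR_double_ge E3 _; lra.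
have {E4}E5 : 3 + 3190 / 10 ^+ 4 + 6258 / 10 ^+ 8 <=
    expR (2 * (2 * (2 * (2 * (2 * z))))).
  by apply: expR_double_ge E4 _; lra.
by apply: expR_double_ge E5 _; lra.
Qed.

Lemma mul_tanh_root : exists2 c, lo < c < hi & c * tanh c = 1.
Proof.
have lohi : lo <= hi by rewrite /mul_tanh_root_lo /mul_tanh_root_hi; lra.
have [||c] := @IVT R (fun x => x * tanh x) lo hi 1 lohi.
- apply: continuous_subspaceT => x.
  by apply: cvgM; [exact: cvg_id|exact: continuous_tanh].
- by rewrite ge_min le_max !(ltW mul_tanh_lo, ltW mul_tanh_hi) orbT.
rewrite in_itv/= => /andP[loc chi] c1; exists c => //.
rewrite !lt_neqAle loc chi !andbT.
apply/andP; split; apply/negP => /eqP ce.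
- by have := mul_tanh_lo; rewrite ce c1 ltxx.
- by have := mul_tanh_hi; rewrite -ce c1 ltxx.
Qed.

End Taylor.

(** * Closed form of the limit and its decimals *)

Section Limit.
Variable R : realType.
Implicit Types x y c : R.

(** The equation for [c] says cosh c = c sinh c, hence c + cosh c sinh c = c (1 + sinh^2 c) = c
    cosh^2 c, and the denominator becomes c cosh c = c^2 sinh c. *)
Lemma sqrt2_sinh_tanh c : 0 < c -> c * tanh c = 1 ->
  Num.sqrt 2 * sinh c / (Num.sqrt c * Num.sqrt (c + cosh c * sinh c))
  = Num.sqrt 2 / c ^+ 2.
Proof.
move=> c0 c1; have s0 := sinh_gt0 c0.
have ch : cosh c = c * sinh c.
  by move: c1; rewrite /tanh mulrA => /divr1_eq.
have h : c + cosh c * sinh c = c * cosh c ^+ 2.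
  have -> : cosh c ^+ 2 = 1 + sinh c ^+ 2 by have := cosh2Bsinh2 c; lra.
  by rewrite ch; ring.
rewrite h sqrtrM ?(ltW c0)// sqrtr_sqr gtr0_norm ?cosh_gt0// mulrA.
rewrite -expr2 sqr_sqrtr ?(ltW c0)// ch; field.
by rewrite !gt_eqF.
Qed.

Lemma sqrt2_bounds c : mul_tanh_root_lo R < c < mul_tanh_root_hi R ->
  982 / 10 ^+ 3 + 61 / 10 ^+ 5 <= Num.sqrt 2 / c ^+ 2
    < 982 / 10 ^+ 3 + 62 / 10 ^+ 5.
Proof.
rewrite /mul_tanh_root_lo /mul_tanh_root_hi => /andP[lo hi].
have lt_sqr (a b : R) : 0 <= a -> a < b -> a ^+ 2 < b ^+ 2.
  by move=> a0 ab; rewrite ltr_pXn2r// nnegrE ltW// (le_lt_trans a0 ab).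
have lo0 : 0 <= 32 * (3748 / 10 ^+ 5 + 9947 / 10 ^+ 9) :> R by clear; lra.
have c0 : 0 < c := le_lt_trans lo0 lo.
have {lo lo0}lo2 : 14392 / 10 ^+ 4 + 280 / 10 ^+ 7 < c ^+ 2.
  by apply: lt_trans (lt_sqr _ _ lo0 lo); clear; lra.
have {hi}hi2 : c ^+ 2 < 14392 / 10 ^+ 4 + 391 / 10 ^+ 7.
  by apply: lt_trans (lt_sqr _ _ (ltW c0) hi) _; clear; lra.
have lt_of_sqr (a b : R) : 0 <= b -> a ^+ 2 < b ^+ 2 -> a < b.
  by clear; nra.
have s2 : Num.sqrt 2 ^+ 2 = 2 :> R by rewrite sqr_sqrtr.
have slo : 14142 / 10 ^+ 4 + 110 / 10 ^+ 7 < Num.sqrt 2 :> R.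
  by apply: lt_of_sqr; [exact: sqrtr_ge0 | rewrite s2; clear; lra].
have shi : Num.sqrt 2 < 14142 / 10 ^+ 4 + 138 / 10 ^+ 7 :> R.
  by apply: lt_of_sqr; [clear; lra | rewrite s2; clear; lra].
(* After multiplication by [c ^+ 2] both bounds are linear in [c ^+ 2] and [Num.sqrt 2]; the
   enclosures above leave a slack below 10^-6 on either side. *)
rewrite ler_pdivlMr ?ltr_pdivrMr ?exprn_gt0//.
clear s2; move: (c ^+ 2) (Num.sqrt 2) lo2 hi2 slo shi => c2 s.
clear; lra.
Qed.

End Limit.

(** * Convergence of the roots and of the inner product *)

Section PathRoots.
Variable R : realType.
Implicit Types x y c : R.

Lemma cvg_div_nat (u : nat -> R) c :
  u n @[n --> \oo] --> c -> u n / n%:R @[n --> \oo] --> (0 : R).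
Proof.
move=> uc; rewrite -(mulr0 c); apply: cvgM => //.
apply/gtr0_cvgV0; last exact: cvgr_idn.
by near=> n; rewrite ltr0n; near: n; exact: nbhs_infty_gt.
Unshelve. all: by end_near. Qed.

Lemma cvg_cosh_div_nat (u : nat -> R) c :
  u n @[n --> \oo] --> c -> cosh (u n / n%:R) @[n --> \oo] --> (1 : R).
Proof.
move=> /cvg_div_nat u0; rewrite -[X in _ --> X]cosh0.
exact: (cvg_comp _ _ u0 (@continuous_cosh R 0)).
Qed.

(** This is y <= sinh y <= y cosh y at y = x / n, the estimate that compares the discrete equation
    with its continuous limit. *)
Lemma sinh_div_nat_bounds x n : (0 < n)%N -> 0 <= x ->
  x <= n%:R * sinh (x / n%:R) <= x * cosh (x / n%:R).
Proof.
move=> n0 x0; have n0R : 0 < n%:R :> R by rewrite ltr0n.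
have y0 : 0 <= x / n%:R by rewrite divr_ge0// ltW.
have xE : x = n%:R * (x / n%:R) by rewrite mulrC divfK ?lt0r_neq0.
move: y0 xE; move: (x / n%:R) => y y0 ->.
by rewrite -mulrA !ler_pM2l// le_sinh// sinh_le.
Qed.

Lemma cvg_sinh_div_nat (u : nat -> R) c : (forall n, 0 <= u n) ->
  u n @[n --> \oo] --> c -> n%:R * sinh (u n / n%:R) @[n --> \oo] --> c.
Proof.
move=> u0 uc.
apply: (@squeeze_cvgr _ _ _ _ u (fun n => u n * cosh (u n / n%:R))) => //.
  near=> n; apply: sinh_div_nat_bounds => //.
  by near: n; exact: nbhs_infty_gt.
rewrite -[X in _ --> X]mulr1; apply: cvgM => //; exact: cvg_cosh_div_nat uc.
Unshelve. all: by end_near. Qed.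

(* Equivalently, n tanh (x / n) tanh x = 1: the discrete form of x tanh x = 1. *)
Definition path_root n x :=
  0 < x /\ n%:R * sinh (x / n%:R) * sinh x = cosh x * cosh (x / n%:R).

(** Inserting n sinh (x / n) <= x cosh (x / n) into the root equation gives 1 <= x tanh x, which
    excludes x < c. *)
Lemma path_root_ge n x c : (0 < n)%N -> path_root n x ->
  0 < c -> c * tanh c = 1 -> c <= x.
Proof.
move=> n0 [x0 xn] c0 c1; rewrite leNgt; apply/negP => xc.
have := ltr_mul_tanh x0 xc; rewrite c1 ltNge => /negP; apply.
have /andP[_ h] := sinh_div_nat_bounds n0 (ltW x0).
have C0 := cosh_gt0 (x / n%:R).
rewrite /tanh mulrA ler_pdivlMr ?cosh_gt0// mul1r -(ler_pM2r C0) -xn.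
by rewrite [leRHS]mulrAC ler_pM2r// sinh_gt0.
Qed.

(** The increasing function n tanh (x / n) tanh x equals 1 at a root, so y <= x makes it at most 1
    at [y]; since n sinh (y / n) >= y, this forces y tanh y <= cosh (y / n). *)
Lemma path_root_lt n x y : (0 < n)%N -> path_root n x ->
  0 < y -> cosh (y / n%:R) < y * tanh y -> x < y.
Proof.
move=> n0 [x0 xn] y0; apply: contraTT; rewrite -!leNgt => yx.
have n0R : 0 < n%:R :> R by rewrite ltr0n.
have le_tanh (a b : R) : a <= b -> tanh a <= tanh b.
  by rewrite le_eqVlt => /predU1P[->//|/ltr_tanh/ltW].
have C0 (a : R) := cosh_gt0 a.
have h1 : n%:R * tanh (x / n%:R) * tanh x = 1.
  rewrite /tanh (mulrA n%:R) mulf_div xn [X in _ / X]mulrC divff//.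
  by rewrite mulf_neq0// lt0r_neq0.
have h2 : n%:R * tanh (y / n%:R) * tanh y <= 1.
  rewrite -[leRHS]h1; apply: ler_pM.
  - by rewrite ltW// mulr_gt0// tanh_gt0// divr_gt0.
  - by rewrite ltW// tanh_gt0.
  - by rewrite ler_pM2l// le_tanh// ler_pM2r ?invr_gt0.
  - exact: le_tanh.
have /andP[h _] := sinh_div_nat_bounds n0 (ltW y0).
move: h2; rewrite {1}/tanh (mulrA n%:R) mulrAC ler_pdivrMr// mul1r; apply: le_trans.
by rewrite ler_pM2r// tanh_gt0.
Qed.

Lemma cvg_path_root (x : nat -> R) c : 0 < c -> c * tanh c = 1 ->
  (\forall n \near \oo, path_root n (x n)) -> x n @[n --> \oo] --> c.
Proof.
move=> c0 c1 xP; apply/cvgrPdist_le => e e0.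
(* The test point c + e has x tanh x > 1 strictly, while cosh ((c + e) / n) tends to 1; so
   eventually the root lies below c + e. *)
have h : 1 < (c + e) * tanh (c + e) by rewrite -[ltLHS]c1 ltr_mul_tanh// ltrDl.
have hn : \forall n \near \oo, cosh ((c + e) / n%:R) < (c + e) * tanh (c + e).
  exact: (cvgr_lt _ (@cvg_cosh_div_nat (fun=> c + e) (c + e) (cvg_cst _)) _ h).
near=> n.
have n0 : (0 < n)%N by near: n; exact: nbhs_infty_gt.
have xn : path_root n (x n) by near: n.
have cx := path_root_ge n0 xn c0 c1.
have xc : x n < c + e.
  apply: (path_root_lt n0 xn); first by rewrite addr_gt0.
  by near: n.
by rewrite ler_norml; lra.
Unshelve. all: by end_near. Qed.

(** With x = n h, this is the sum of the vector cosh (h (2 k - n + 1)) divided by sqrt n times its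
    Euclidean norm: the sum is sinh x / sinh h and the squared norm is (n + sinh (2 x) / sinh (2 h))
    / 2. *)
Definition path_inner n x : R :=
  Num.sqrt 2 * sinh x / (n%:R * sinh (x / n%:R)) /
    Num.sqrt (1 + sinh (2 * x) / (n%:R * sinh (2 * x / n%:R))).

Lemma cvg_path_inner (x : nat -> R) c : 0 < c -> (forall n, 0 <= x n) ->
  x n @[n --> \oo] --> c ->
  path_inner n (x n) @[n --> \oo] -->
  Num.sqrt 2 * sinh c / (Num.sqrt c * Num.sqrt (c + cosh c * sinh c)).
Proof.
move=> c0 x0 xc.
have sc : 0 < sinh c := sinh_gt0 c0.
have q0 : 0 < c + cosh c * sinh c by rewrite addr_gt0// mulr_gt0// cosh_gt0.
(* The limit is put in the form that arises on replacing n sinh (x / n) by c and n sinh (2 x / n) by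
   2 c. *)
have -> : Num.sqrt 2 * sinh c / (Num.sqrt c * Num.sqrt (c + cosh c * sinh c))
    = Num.sqrt 2 * sinh c / c / Num.sqrt (1 + sinh (2 * c) / (2 * c)).
  have -> : 1 + sinh (2 * c) / (2 * c) = (c + cosh c * sinh c) / c.
    have -> : sinh (2 * c) = 2 * sinh c * cosh c.
      by rewrite mulr_natl mulr2n sinhD; ring.
    field.
    by rewrite gt_eqF.
  rewrite sqrtrM ?(ltW q0)// sqrtrV ?(ltW c0)//.
  rewrite -[X in _ = _ / X / _](sqr_sqrtr (ltW c0)); field.
  by rewrite !gt_eqF ?sqrtr_gt0.
have cvg_sinh (u : nat -> R) d : u n @[n --> \oo] --> d ->
    sinh (u n) @[n --> \oo] --> sinh d.
  by move=> ud; exact: (cvg_comp _ _ ud (@continuous_sinh R d)).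
have x2 : 2 * x n @[n --> \oo] --> 2 * c by apply: cvgM => //; exact: cvg_cst.
have d0 : 0 < 1 + sinh (2 * c) / (2 * c).
  have c2 : 0 < 2 * c by rewrite mulr_gt0.
  by rewrite addr_gt0// divr_gt0// sinh_gt0.
apply: cvgM; last first.
  apply: cvgV; first by rewrite gt_eqF// sqrtr_gt0.
  apply: continuous_cvg; first exact: sqrt_continuous.
  apply: cvgD; first exact: cvg_cst.
  apply: cvgM; first exact: cvg_sinh.
  apply: cvgV; first by rewrite gt_eqF// mulr_gt0.
  by apply: cvg_sinh_div_nat => // n; rewrite mulr_ge0.
apply: cvgM; first by apply: cvgM; [exact: cvg_cst | exact: cvg_sinh].
by apply: cvgV; [rewrite gt_eqF | exact: cvg_sinh_div_nat].
Qed.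

End PathRoots.

(** * Distances in the path graph *)

Section PathDistance.
Variable n : nat.
Implicit Types i j : 'I_n.

Lemma path_path_graph_last i p : path (@path_graph n) i p ->
  (last i p <= i + size p)%N && (i <= last i p + size p)%N.
Proof.
elim: p i => [|k p IH] i /=; first by rewrite addn0 leqnn.
by move=> /andP[ik /IH]; move: ik; rewrite /path_graph; lia.
Qed.

(** With truncated subtraction the length is |i - j|; the walk is built by induction on it, stepping
    towards [j]. *)
Lemma path_path_graph_exists i j : exists2 p : seq 'I_n,
  size p = (i - j + (j - i))%N & path (@path_graph n) i p && (last i p == j).
Proof.
have [d dE] := ubnP (i - j + (j - i))%N.
elim: d i dE => // d IH i dE; have [ij|ji|ij] := ltngtP i j.
- have i1 : (i.+1 < n)%N by apply: leq_ltn_trans ij _.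
  have [|p sp pp] := IH (Ordinal i1); first by move: dE => /=; lia.
  exists (Ordinal i1 :: p) => /=; first by rewrite sp /=; lia.
  by rewrite -andbA pp andbT /path_graph/= eqxx.
- have i1 : (i.-1 < n)%N by have := ltn_ord i; lia.
  have [|p sp pp] := IH (Ordinal i1); first by move: dE => /=; lia.
  exists (Ordinal i1 :: p) => /=; first by rewrite sp /=; lia.
  by rewrite -andbA pp andbT /path_graph/=; apply/orP; right; apply/eqP; lia.
- by exists [::]; rewrite /= ?ij; [lia | apply/eqP/val_inj].
Qed.

Lemma graph_dist_path_graph i j :
  graph_dist (@path_graph n) i j = (i - j + (j - i))%N.
Proof.
rewrite /graph_dist card_ord; set a := (X in find X _); set d := (RHS).
have ad : a d.
  have [p sp pp] := path_path_graph_exists i j.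
  by apply/existsP; exists (tcast sp (in_tuple p)); rewrite val_tcast.
(* The bounded search covers the lengths below [n], so it reaches [d] and its default value does not
   occur. *)
have dn : (d < n)%N by rewrite /d; have := ltn_ord i; have := ltn_ord j; lia.
have ha : has a (iota 0 n) by apply/hasP; exists d; rewrite ?mem_iota.
have fn : (find a (iota 0 n) < n)%N by rewrite -{2}(size_iota 0 n) -has_find.
apply/eqP; rewrite eqn_leq; apply/andP; split.
  rewrite leqNgt; apply/negP => df.
  by have := before_find 0%N df; rewrite nth_iota// add0n ad.
have := nth_find 0%N ha; rewrite nth_iota// add0n => /existsP[p /andP[pp /eqP lp]].
by have := path_path_graph_last pp; rewrite lp size_tuple /d; lia.
Qed.

End PathDistance.

(** * Explicit eigenvectors of the matrix |i - j| *)

Section PathEigenvector.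
Variable R : realType.

(** The sum telescopes, because 2 sinh h cosh u = sinh (u + h) - sinh (u - h). *)
Lemma sum_cosh_arith (h b : R) n :
  2 * sinh h * \sum_(k < n) cosh (h * (2 * k%:R) + b) =
  sinh (h * (2 * n%:R - 1) + b) - sinh (b - h).
Proof.
elim: n => [|n IH].
  by rewrite big_ord0 mulr0 [X in sinh X - _](_ : _ = b - h) ?subrr//; ring.
rewrite big_ord_recr/= mulrDr IH.
rewrite (_ : h * (2 * n.+1%:R - 1) + b = h * (2 * n%:R) + b + h); last first.
  by rewrite -natr1; ring.
rewrite (_ : h * (2 * n%:R - 1) + b = h * (2 * n%:R) + b - h); last by ring.
by rewrite (sinhD _ h) (sinhB (_ + b)); ring.
Qed.

Lemma sum_cosh_centered (h : R) n :
  sinh h * \sum_(k < n) cosh (h * (2 * k%:R - (n%:R - 1))) = sinh (n%:R * h).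
Proof.
have h1 := sum_cosh_arith h (- (h * (n%:R - 1))) n.
rewrite (eq_bigr (fun k : 'I_n => cosh (h * (2 * k%:R) - h * (n%:R - 1)))); last first.
  by move=> k _; congr cosh; ring.
move: h1; rewrite (_ : h * (2 * n%:R - 1) - h * (n%:R - 1) = n%:R * h); last by ring.
rewrite (_ : - (h * (n%:R - 1)) - h = - (n%:R * h)); last by ring.
by rewrite sinhN => h1; lra.
Qed.

(** The witness is arsinh s = ln (s + sqrt (s^2 + 1)). It serves to solve 2 a sinh(h)^2 = 1 for
    [h]. *)
Lemma exists_sinh (s : R) : exists h, sinh h = s.
Proof.
have q0 : 0 <= s ^+ 2 + 1 by rewrite addr_ge0// sqr_ge0.
have sq := sqr_sqrtr q0; have := sqrtr_ge0 (s ^+ 2 + 1).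
move: sq; set q := Num.sqrt _ => sq q1.
have e0 : 0 < s + q by nra.
exists (ln (s + q)); rewrite /sinh expRN lnK ?posrE//.
have -> : (s + q)^-1 = q - s.
  apply: (mulfI (lt0r_neq0 e0)); rewrite divff ?lt0r_neq0//.
  by lra.
by lra.
Qed.

Lemma cosh_double (h : R) : cosh (h + h) = 1 + 2 * sinh h ^+ 2.
Proof. by rewrite coshD; have := cosh2Bsinh2 h; lra. Qed.

Lemma cosh_second_difference (h u : R) :
  cosh (u + (h + h)) = (2 + 4 * sinh h ^+ 2) * cosh u - cosh (u - (h + h)).
Proof. by rewrite coshD coshB cosh_double; ring. Qed.

Lemma sinh_second_difference (h u : R) :
  sinh (u + (h + h)) = (2 + 4 * sinh h ^+ 2) * sinh u - sinh (u - (h + h)).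
Proof. by rewrite sinhD sinhB cosh_double; ring. Qed.

Section Equations.
(** Here [N] is the last index, so the path has [N.+1] vertices. Indexing by [nat] makes
    neighbouring entries directly expressible. *)
Variables (N : nat) (a : R) (w : nat -> R).
Hypothesis N1 : (0 < N)%N.
Hypothesis wD : forall i, (i <= N)%N ->
  a * w i = \sum_(j < N.+1) (i - j + (j - i))%:R * w j.

Let S := \sum_(j < N.+1) w j.

(** Writing a single entry as a sum over [j] turns each relation between rows below into an identity
    of natural coefficients. *)
Lemma sum_delta i c : (i <= N)%N ->
  \sum_(j < N.+1) (c * (j == i :> nat))%:R * w j = c%:R * w i.
Proof.
rewrite -ltnS => iN; rewrite (bigD1 (Ordinal iN))//= eqxx muln1 big1 ?addr0//.
by move=> j; rewrite -val_eqE/= => /negPf ->; rewrite muln0 mul0r.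
Qed.

(** The second difference of |i - j| in [i] is 2 at the centre j = i + 1 and 0 elsewhere. *)
Lemma path_eigen_recurrence i : (i.+2 <= N)%N ->
  a * (w i.+2 + w i) = 2 * (a * w i.+1) + 2 * w i.+1.
Proof.
move=> iN; rewrite mulrDr !wD; try lia.
rewrite -[X in _ = _ + X](sum_delta 2 (ltnW iN)) mulr_sumr -!big_split/=.
apply: eq_bigr => j _; rewrite -!mulrDl mulrA -natrM -mulrDl -!natrD.
by congr (_%:R * _); case: (eqVneq (j : nat) i.+1) => ji; lia.
Qed.

(** Going from vertex 1 to vertex 0 raises every distance by 1, except that to vertex 0, which drops
    by 1. *)
Lemma path_eigen_first : a * w 1%N + S = a * w 0%N + 2 * w 0%N.
Proof.
rewrite !wD// -(sum_delta 2 (leq0n N)) -!big_split/=.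
apply: eq_bigr => j _; rewrite -{2}(mul1r (w j)) -!mulrDl -natrD natr1.
by congr (_%:R * _); case: (eqVneq (j : nat) 0%N) => ji; lia.
Qed.

Lemma path_eigen_last : a * w N.-1 + S = a * w N + 2 * w N.
Proof.
rewrite !wD ?leq_pred// -(sum_delta 2 (leqnn N)) -!big_split/=.
apply: eq_bigr => j _; rewrite -{2}(mul1r (w j)) -!mulrDl -natrD natr1.
have jN := ltn_ord j.
by congr (_%:R * _); case: (eqVneq (j : nat) N) => ji; lia.
Qed.

(** The distances from any vertex to the two ends add up to [N]. *)
Lemma path_eigen_ends : a * (w 0%N + w N) = N%:R * S.
Proof.
rewrite mulrDr !wD// mulr_sumr -big_split/=.
apply: eq_bigr => j _; rewrite -mulrDl -natrD.
by congr (_%:R * _); have := ltn_ord j; lia.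
Qed.

(* Twice h is the exponent of the recurrence: 2 cosh (2 h) - 2 = 2 / a. *)
Variable h : R.
Hypothesis h0 : 0 < h.
Hypothesis ah : 2 * a * sinh h ^+ 2 = 1.

Let u (k : nat) : R := h * (2 * k%:R - N%:R).

Let uS k : u k.+1 = u k + (h + h).
Proof. by rewrite /u -natr1; ring. Qed.

Let a0 : 0 < a.
Proof. by have := sinh_gt0 h0; move: ah; nra. Qed.

Lemma path_eigen_general : exists A B : R,
  forall k, (k <= N)%N -> w k = A * cosh (u k) + B * sinh (u k).
Proof.
have hh0 : 0 < h + h by rewrite addr_gt0.
have d0 : sinh (h + h) != 0 by rewrite lt0r_neq0// sinh_gt0.
have dE : cosh (u 0%N) * sinh (u 1%N) - cosh (u 1%N) * sinh (u 0%N) = sinh (h + h).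
  rewrite (_ : h + h = u 1%N - u 0%N); last by rewrite uS; ring.
  by rewrite sinhB; ring.
(* Cramer's rule fits the entries 0 and 1; the determinant is sinh (2 h), nonzero by [d0]. The
   recurrence then propagates the fit, two consecutive entries at a time. *)
pose A := (w 0%N * sinh (u 1%N) - w 1%N * sinh (u 0%N)) / sinh (h + h).
pose B := (cosh (u 0%N) * w 1%N - cosh (u 1%N) * w 0%N) / sinh (h + h).
have AE : sinh (h + h) * A = w 0%N * sinh (u 1%N) - w 1%N * sinh (u 0%N).
  by rewrite mulrC divfK.
have BE : sinh (h + h) * B = cosh (u 0%N) * w 1%N - cosh (u 1%N) * w 0%N.
  by rewrite mulrC divfK.
clearbody A B; exists A, B => k kN.
suff [] : w k = A * cosh (u k) + B * sinh (u k) /\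
  ((k < N)%N -> w k.+1 = A * cosh (u k.+1) + B * sinh (u k.+1)) by [].
elim: k kN => [|k IH] kN.
  split => [|_]; apply: (mulfI d0); rewrite mulrDr (mulrA _ A) (mulrA _ B).
    by rewrite AE BE -dE; ring.
  by rewrite AE BE -dE; ring.
have [wk /(_ kN) wk1] := IH (ltnW kN); split => // k1N.
have rec := path_eigen_recurrence k1N.
have s4 : 4 * sinh h ^+ 2 = 2 / a.
  by apply: (mulfI (lt0r_neq0 a0)); rewrite [RHS]mulrC divfK ?lt0r_neq0//; have := ah; lra.
have -> : w k.+2 = (2 + 4 * sinh h ^+ 2) * w k.+1 - w k.
  rewrite s4; apply: (mulfI (lt0r_neq0 a0)).
  have -> : a * ((2 + 2 / a) * w k.+1 - w k) = (2 * a + 2) * w k.+1 - a * w k.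
    by field; rewrite lt0r_neq0.
  by move: rec; lra.
rewrite (uS k.+1) cosh_second_difference sinh_second_difference.
rewrite (_ : u k.+1 - (h + h) = u k); last by rewrite uS; ring.
by rewrite wk1 wk; ring.
Qed.

(* The sinh component is odd about the centre of the path; the difference of
   the first and last rows of the eigenvalue equation rules it out. *)
Lemma path_eigen_even : exists A : R,
  forall k, (k <= N)%N -> w k = A * cosh (u k).
Proof.
have [A [B wE]] := path_eigen_general; exists A => k kN.
suff B0 : B = 0 by rewrite wE// B0 mul0r addr0.
have := path_eigen_last; have := path_eigen_first.
rewrite !wE ?leq_pred//.
have uN : u N = - u 0%N by rewrite /u; ring.
have uN1 : u N.-1 = - u 1%N.
  by rewrite /u -[in N%:R](prednK N1) -natr1 /=; ring.
rewrite uN uN1 !coshN !sinhN => e1 e2.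
have U0 : 0 < - u 0%N by rewrite /u mulr0 sub0r mulrN opprK mulr_gt0 ?ltr0n.
have U1 : sinh (- u 1%N) < sinh (- u 0%N).
  by apply: ltr_sinh; rewrite uS; have := h0; lra.
(* Subtracting the end rows cancels [S] and the cosh terms; the factor left beside [B] is
   positive. *)
have : B * (a * (sinh (- u 0%N) - sinh (- u 1%N)) + 2 * sinh (- u 0%N)) = 0.
  by rewrite !sinhN; lra.
move/eqP; rewrite mulf_eq0 => /orP[/eqP//|/eqP e].
have := sinh_gt0 U0; have : 0 < a * (sinh (- u 0%N) - sinh (- u 1%N)).
  by rewrite mulr_gt0 ?subr_gt0.
by lra.
Qed.

Hypothesis w0 : forall k, (k <= N)%N -> 0 <= w k.
Hypothesis w1 : \sum_(k < N.+1) w k ^+ 2 = 1.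

Lemma path_eigen_root : let x := N.+1%:R * h in
  path_root N.+1 x /\
  S / Num.sqrt N.+1%:R = path_inner N.+1 x.
Proof.
move=> x; rewrite /path_inner; have [A wE] := path_eigen_even.
have nE : N%:R = N.+1%:R - 1 :> R by rewrite -natr1 addrK.
have n0 : 0 < N.+1%:R :> R by rewrite ltr0n.
have x0 : 0 < x by rewrite mulr_gt0.
have sh := sinh_gt0 h0.
have sh2 : 0 < sinh (2 * h) by rewrite sinh_gt0// mulr_gt0.
have hx : x / N.+1%:R = h by rewrite /x mulrC mulKf// lt0r_neq0.
have hx2 : 2 * x / N.+1%:R = 2 * h by rewrite -mulrA hx.
have SE : sinh h * S = A * sinh x.
  rewrite -(sum_cosh_centered h) [RHS]mulrCA -nE; congr (_ * _); rewrite mulr_sumr.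
  by apply: eq_bigr => k _; rewrite wE// -ltnS.
(* The unit norm, with 2 cosh^2 u = 1 + cosh (2 u) and the centred sum taken at 2 h. *)
have QE : sinh (2 * h) * 2 = A ^+ 2 * (sinh (2 * h) * N.+1%:R + sinh (2 * x)).
  rewrite (_ : 2 * x = N.+1%:R * (2 * h)); last by rewrite /x; ring.
  rewrite -(sum_cosh_centered (2 * h)) -mulrDr mulrCA; congr (_ * _).
  rewrite -[LHS]mulr1 -[X in _ * X = _]w1 mulr_sumr.
  have -> : N.+1%:R = \sum_(k < N.+1) 1 :> R by rewrite sumr_const card_ord.
  rewrite -big_split/= mulr_sumr; apply: eq_bigr => k _.
  rewrite sumr_const card_ord wE -1?ltnS// exprMn mulrCA; congr (_ * _).
  rewrite -nE (_ : 2 * h * (2 * k%:R - N%:R) = u k + u k); last by rewrite /u; ring.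
  by rewrite coshD; have := cosh2Bsinh2 (u k); lra.
(* Nonnegativity of the entries fixes the sign of [A], which [AQ] determines only up to sign. *)
have A0 : 0 <= A.
  by have := w0 (leq0n N); rewrite wE// pmulr_lge0// cosh_gt0.
set Q := sinh (2 * x) / (N.+1%:R * sinh (2 * x / N.+1%:R)).
have Q0 : 0 <= Q.
  have s2x : 0 < sinh (2 * x) by rewrite sinh_gt0// mulr_gt0.
  by rewrite /Q hx2 ltW// divr_gt0// mulr_gt0.
have AQ : A ^+ 2 * N.+1%:R * (1 + Q) = 2.
  apply: (mulfI (lt0r_neq0 sh2)); rewrite QE /Q hx2; field.
  by rewrite !lt0r_neq0.
split.
  split=> //; rewrite hx.
  have A1 : A != 0.
    apply/eqP => AE; move: AQ; rewrite AE expr0n/= !mul0r => /esym/eqP.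
    by rewrite pnatr_eq0.
  (* Both end entries are A cosh (x - h), so [path_eigen_ends] yields cosh (x - h) = N sinh h sinh
     x. Expanding the left side moves one more sinh h sinh x to the right and turns [N] into
     [N.+1]. *)
  have uN : cosh (u N) = cosh (x - h).
    by congr cosh; rewrite /u nE /x; ring.
  have u0E : cosh (u 0%N) = cosh (u N).
    by rewrite -coshN; congr cosh; rewrite /u; ring.
  have := path_eigen_ends; rewrite !wE// u0E uN => e.
  have {}e : A * cosh (x - h) = N%:R * sinh h * (A * sinh x).
    rewrite -SE.
    have -> : N%:R * sinh h * (sinh h * S) = sinh h ^+ 2 * (N%:R * S) by ring.
    by rewrite -e -[LHS]mul1r -[X in X * _ = _]ah; ring.
  have {}e : cosh (x - h) = N%:R * sinh h * sinh x.
    by apply: (mulfI A1); rewrite e; ring.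
  by move: e; rewrite coshB nE; lra.
rewrite hx.
have -> : S = A * sinh x / sinh h by rewrite -SE mulrC mulKf// lt0r_neq0.
have sA : A * Num.sqrt N.+1%:R * Num.sqrt (1 + Q) = Num.sqrt 2.
  have AN : 0 <= A ^+ 2 * N.+1%:R by rewrite mulr_ge0 ?sqr_ge0// ltW.
  by rewrite -AQ (sqrtrM _ AN) (sqrtrM _ (sqr_ge0 A)) sqrtr_sqr ger0_norm.
have q0 : 0 < Num.sqrt (1 + Q) by rewrite sqrtr_gt0; lra.
have r0 : 0 < Num.sqrt N.+1%:R :> R by rewrite sqrtr_gt0.
rewrite -sA -[X in _ = _ / (X * _) / _](sqr_sqrtr (ltW n0)); field.
by rewrite !lt0r_neq0.
Qed.
End Equations.

End PathEigenvector.

(** * From Perron-Frobenius vectors to the limit *)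

Lemma eigenspace_gt0 (R : realType) n (D : 'M[R]_n) (v : 'rV[R]_n) a :
  (1 < n)%N -> (forall i j, i != j -> 0 < D i j) -> (forall i, 0 <= D i i) ->
  (forall i, 0 <= v 0 i) -> v != 0 -> v *m D = a *: v -> 0 < a.
Proof.
move=> n1 Dpos Ddiag v0 vn0 vD.
have D0 i j : 0 <= D i j by have [<-//|/Dpos/ltW] := eqVneq i j.
have [i vi] : exists i, 0 < v 0 i.
  apply/existsP; apply: contraNT vn0; rewrite negb_exists => /forallP h.
  by apply/eqP/rowP => i; rewrite mxE; apply/eqP; rewrite eq_le v0 andbT leNgt h.
have [j ij] : exists j, i != j.
  apply/existsP; apply: contraLR n1; rewrite negb_exists -leqNgt => /forallP h.
  rewrite -[n]card_ord -(cards1 i) -cardsT subset_leq_card//.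
  by apply/fintype.subsetP => k _; rewrite inE eq_sym; have := h k; rewrite negbK.
(* Entry [j] of [v *m D] is at least v_i D_ij > 0; as it equals a v_j with v_j >= 0, [a] is
   positive. *)
have : 0 < (a *: v) 0 j.
  rewrite -vD mxE (bigD1 i)//= ltr_wpDr ?mulr_gt0 ?Dpos//.
  by apply: sumr_ge0 => k _; rewrite mulr_ge0.
by rewrite mxE => av; have := v0 j; nra.
Qed.

Lemma path_perron (R : realType) n (v : 'rV[R]_n) : (2 <= n)%N ->
  perron_frobenius_vector (distance_matrix R (@path_graph n)) v ->
  l2norm v = 1 ->
  exists x, path_root n x /\
    inner v ((Num.sqrt n%:R)^-1 *: const_mx 1) = path_inner n x.
Proof.
case: n v => // N v N1 [a [_ _ /eigenspaceP vD vn0 v0]] v1.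
set D := distance_matrix _ _ in vD.
have DE i j : D i j = (i - j + (j - i))%:R by rewrite mxE graph_dist_path_graph.
have a0 : 0 < a.
  apply: (eigenspace_gt0 _ _ _ v0 vn0 vD) => // [i j ij|i].
  - rewrite DE ltr0n; move: ij; rewrite -val_eqE/=; lia.
  - by rewrite DE.
have [h hE] := exists_sinh (Num.sqrt (2 * a)^-1).
have ah : 2 * a * sinh h ^+ 2 = 1.
  by rewrite hE sqr_sqrtr ?divff ?invr_ge0// ?mulr_ge0 ?mulf_neq0 ?lt0r_neq0// ltW.
have h0 : 0 < h.
  rewrite ltNge; apply/negP => h0; have := sinh_ge0 (x := - h).
  rewrite oppr_ge0 sinhN oppr_ge0 => /(_ h0); apply/negP.
  by rewrite -ltNge hE sqrtr_gt0 invr_gt0 mulr_gt0.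
(* Beyond [N], [inord] falls back to index 0; the equations only involve indices up to [N]. *)
pose w k := v 0 (inord k).
have wE (i : 'I_N.+1) : w i = v 0 i by rewrite /w inord_val.
have wD i : (i <= N)%N ->
    a * w i = \sum_(j < N.+1) (i - j + (j - i))%:R * w j.
  rewrite -ltnS => iN; rewrite (wE (Ordinal iN)).
  have /rowP/(_ (Ordinal iN)) := vD; rewrite !mxE => <-.
  by apply: eq_bigr => j _; rewrite DE wE mulrC addnC.
have w0 k : (k <= N)%N -> 0 <= w k by rewrite /w.
have w1 : \sum_(k < N.+1) w k ^+ 2 = 1.
  move: v1; rewrite /l2norm /inner => /(congr1 (fun x => x ^+ 2)).
  rewrite sqr_sqrtr ?expr1n; last by apply: sumr_ge0 => i _; rewrite -expr2 sqr_ge0.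
  by move=> <-; apply: eq_bigr => k _; rewrite wE.
have [xr xE] := path_eigen_root N1 wD h0 ah w0 w1.
exists (N.+1%:R * h); split=> //; rewrite -xE /inner mulr_suml.
by apply: eq_bigr => k _; rewrite !mxE mulr1 wE.
Qed.

Theorem proposition2 (R : realType) (v : forall n : nat, 'rV[R]_n)
    (hPF : forall n : nat, (2 <= n)%N ->
       perron_frobenius_vector (distance_matrix R (@path_graph n)) (v n))
    (hnorm : forall n : nat, (2 <= n)%N -> l2norm (v n) = 1) :
  exists c : R,
    [/\ 0 < c /\ c * tanh c = 1,
        forall x : R, 0 < x -> x * tanh x = 1 -> x = c,
        inner (v n) ((Num.sqrt n%:R)^-1 *: const_mx 1) @[n --> \oo] -->
          Num.sqrt 2 * sinh c / (Num.sqrt c * Num.sqrt (c + cosh c * sinh c))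
      & 982 / 10 ^+ 3 + 61 / 10 ^+ 5 <=
          Num.sqrt 2 * sinh c / (Num.sqrt c * Num.sqrt (c + cosh c * sinh c))
          < 982 / 10 ^+ 3 + 62 / 10 ^+ 5].
Proof.
have [c cb c1] := mul_tanh_root R.
have c0 : 0 < c.
  have /andP[lo _] := cb; apply: lt_trans lo.
  by rewrite /mul_tanh_root_lo; lra.
exists c; split=> //.
- move=> x x0 x1; have [xc|cx|//] := ltgtP x c.
  + by have := ltr_mul_tanh x0 xc; rewrite c1 x1 ltxx.
  + by have := ltr_mul_tanh c0 cx; rewrite c1 x1 ltxx.
(* One root is chosen for each n >= 2, and 0 for smaller [n], because [cvg_path_inner] asks for a
   sequence nonnegative at every index. *)
- have /choice[x xP] n : exists x : R, 0 <= x /\ ((2 <= n)%N -> path_root n x /\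
      inner (v n) ((Num.sqrt n%:R)^-1 *: const_mx 1) = path_inner n x).
    have [n2|_] := leqP 2 n; last by exists 0.
    have [x [xr xE]] := path_perron n2 (hPF _ n2) (hnorm _ n2).
    by exists x; split=> //; case: xr => /ltW.
  have xc : x n @[n --> \oo] --> c.
    apply: cvg_path_root => //; near=> n.
    by have [_ []] := xP n; first by near: n; exact: nbhs_infty_gt.
  have := cvg_path_inner c0 (fun n => (xP n).1) xc.
  apply: cvg_trans; apply: near_eq_cvg; near=> n.
  by have [_ [|_ ->]] := xP n; first by near: n; exact: nbhs_infty_gt.
- rewrite sqrt2_sinh_tanh//; exact: sqrt2_bounds.
Unshelve. all: by end_near. Qed.
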